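(* Let $a,c\le 0$ and consider, on $\mathbb{T}$, the $abcd$-Boussinesq system with $b=d=0$: $$h_t+\partial_x\left(a\,\partial_x^2u+hu\right)=0,$$ $$u_t+\partial_x\left(c\,\partial_x^2h+h\right)+u\,\partial_x u=0.$$ Let $(h,u)$ be a smooth solution having maximal lifespan $T_{\max}\in(0,\infty]$. Assume that $h$ is an even function of $x$ and $u$ is an odd function of $x$. Assume furthermore that there exist $\omega\in(0,\pi]$ and $\sigma>0$ such that, for all $(x,t)\in[0,\omega]\times[0,T_{\max})$, (1) $h(x,t)<-\sigma$; (2) $u(x,t)\le 0$; (3) $\partial_x h(x,t)\ge 0$; (4) $c\,\partial_x^3h(x,t)\ge 0$; (5) $a\,\partial_x^2u(x,t)\ge 0$. Then $T_{\max}<\infty$.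
   Context: $\mathbb{T}=[-\pi,\pi]$ with periodic boundary conditions (functions are real-valued and $2\pi$-periodic in $x$). The general $abcd$-Boussinesq system, with parameters $\mu=\epsilon=1$ and $h=1+\eta$, is $(1-b\partial_x^2)h_t+\partial_x(a\partial_x^2u+hu)=0$, $(1-d\partial_x^2)u_t+\partial_x(c\partial_x^2h+\eta)+u\partial_xu=0$. Standing assumptions: $\eta=h-1$ has zero mean, i.e. $\int_{-\pi}^{\pi}(h(x,t)-1)\,dx=0$ (a condition propagated in time from the initial data), and $\int_{-\pi}^{\pi}u(x,t)\,dx=0$. The maximal lifespan $T_{\max}$ is the supremum of the times up to which the solution exists and remains smooth. *)

(* Defs.v *)
From Stdlib Require Import Reals.
From Coquelicot Require Import Coquelicot.
Open Scope R_scope.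

(* C^oo on R x [0,T), up to and including t = 0: f is there the restriction of
   a function that is C^oo on the open set R x (-oo,T). Only the values of f
   on R x [0,T) matter, so f may be arbitrary elsewhere. *)
Definition smooth_upto (T : Rbar) (f : R -> R -> R) : Prop :=
  exists F : R -> R -> R,
    (forall (n : nat) (x t : R), Rbar_lt t T -> ex_diff_n F n x t) /\
    (forall x t : R, 0 <= t -> Rbar_lt t T -> F x t = f x t).

Definition periodic_upto (T : Rbar) (f : R -> R -> R) : Prop :=
  forall x t : R, 0 <= t -> Rbar_lt t T -> f (x + 2 * PI) t = f x t.

(* The abcd-Boussinesq system with b = d = 0 at the point (x,t). *)
Definition boussinesq_at (a c : R) (h u : R -> R -> R) (x t : R) : Prop :=
  Derive (fun s => h x s) t
    + Derive (fun y => a * Derive_n (fun z => u z t) 2 y + h y t * u y t) x = 0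
  /\
  Derive (fun s => u x s) t
    + Derive (fun y => c * Derive_n (fun z => h z t) 2 y + h y t) x
    + u x t * Derive (fun y => u y t) x = 0.

(* [Derive] in t is two-sided, so the system is imposed for 0 < t; by smoothness
   up to t = 0 it then holds at t = 0 with the right-sided time derivative. *)
Definition smooth_solution (a c : R) (T : Rbar) (h u : R -> R -> R) : Prop :=
  smooth_upto T h /\ smooth_upto T u /\
  periodic_upto T h /\ periodic_upto T u /\
  (forall x t : R, 0 < t -> Rbar_lt t T -> boussinesq_at a c h u x t).

(* The solution (h,u), given on [0,T), exists and remains smooth up to T':
   it is the restriction to the common time interval of a smooth solution on
   [0,T') (for T' <= T, (h,u) itself will do). *)
Definition exists_smooth_upto (a c : R) (T : Rbar) (h u : R -> R -> R)
    (T' : Rbar) : Prop :=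
  Rbar_lt 0 T' /\
  exists h' u' : R -> R -> R,
    smooth_solution a c T' h' u' /\
    (forall x t : R, 0 <= t -> Rbar_lt t T -> Rbar_lt t T' ->
       h' x t = h x t /\ u' x t = u x t).

Definition maximal_smooth_solution (a c : R) (Tmax : Rbar) (h u : R -> R -> R)
    : Prop :=
  Rbar_lt 0 Tmax /\
  smooth_solution a c Tmax h u /\
  Rbar_is_lub (exists_smooth_upto a c Tmax h u) Tmax.

(* Main.v *)
Require Import Defs.
From Stdlib Require Import Reals Lra.
From Coquelicot Require Import Coquelicot.
Open Scope R_scope.

(** The blow-up is driven by the weighted momentum
    [B(t) = int_0^pi (pi - x) u(x,t) dx].  Writing the second equation as
    [u_t = - P_x] with [P = c h_xx + h + u^2/2], one integration by parts gives
    [B' = pi P(0,t) - int_0^pi P dx].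

    Parity and periodicity make both terms explicit.  Since [h] is even about
    [0] and about [pi], [h_x] vanishes at both points, so [c h_xx] integrates
    to zero; evenness also turns the zero-mean condition into
    [int_0^pi h dx = pi]; and [u(0,t) = 0] as [u] is odd.  Hence
    [B' = pi (c h_xx(0,t) + h(0,t)) - pi - (1/2) int_0^pi u^2 dx].

    Next to the origin [h_x] starts from [0] and is nonnegative, so
    [h_xx(0,t) >= 0] and [c h_xx(0,t) <= 0], while [h(0,t) < 0].  Together with
    a Cauchy-Schwarz bound for [B] ([square_first_moment_le]) this yields
    [B' <= - (1 + B^2 / (2 pi^3))].  No function satisfies such an inequality
    for all positive times ([no_global_riccati]), because [atan (sqrt k * B)]
    would then decrease at a linear rate while staying bounded. *)

(** * Calculus of one variable *)

Lemma ex_RInt_of_continuous (f : R -> R) (a b : R) :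
  (forall x, continuous f x) -> ex_RInt f a b.
Proof.
  intros Hf; apply (ex_RInt_continuous (V := R_CompleteNormedModule)).
  intros x _; apply Hf.
Qed.

(** The map [atan (sqrt k * B)] linearises the Riccati inequality: its
    derivative is at most [- sqrt k], so it would drop by [PI], the full width
    of the range of [atan], over a time interval of length [PI / sqrt k]. *)
Lemma no_global_riccati (B dB : R -> R) (k : R) :
  0 < k ->
  (forall t, 0 < t -> is_derive B t (dB t)) ->
  (forall t, 0 < t -> dB t <= - (1 + k * (B t) ^ 2)) ->
  False.
Proof.
  intros Hk HB HdB.
  assert (Hs : 0 < sqrt k) by now apply sqrt_lt_R0.
  assert (Hss : sqrt k * sqrt k = k) by (apply sqrt_sqrt; lra).
  pose proof PI_RGT_0 as Hpi.
  assert (HL : 0 < PI / sqrt k) by now apply Rdiv_lt_0_compat.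
  set (g := fun t => atan (sqrt k * B t)).
  set (dg := fun t => sqrt k * dB t * / (1 + k * (B t) ^ 2)).
  assert (Hg : forall t, 0 < t -> is_derive g t (dg t)).
  { intros t Ht; unfold g, dg.
    replace (sqrt k * dB t * / (1 + k * B t ^ 2))
      with (scal (sqrt k * dB t) (/ (1 + Rsqr (sqrt k * B t)))).
    - apply (is_derive_comp atan (fun s => sqrt k * B s)).
      + apply is_derive_atan.
      + now apply (is_derive_scal B t (sqrt k)), HB.
    - unfold scal; simpl; unfold mult; simpl; unfold Rsqr.
      replace (sqrt k * B t * (sqrt k * B t)) with (k * (B t * (B t * 1)));
        [reflexivity | rewrite <- Hss at 1; ring]. }
  destruct (MVT_gen g 1 (1 + PI / sqrt k) dg) as [t [Ht Heq]].
  - intros x; rewrite Rmin_left by lra; intros Hx; apply Hg; lra.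
  - intros x; rewrite Rmin_left by lra; intros Hx.
    apply continuity_pt_filterlim, (ex_derive_continuous g).
    exists (dg x); apply Hg; lra.
  - rewrite Rmin_left in Ht by lra.
    assert (Hdg : dg t <= - sqrt k).
    { unfold dg.
      assert (Hpos : 0 < 1 + k * B t ^ 2)
        by (pose proof (pow2_ge_0 (B t)); nra).
      apply (Rmult_le_reg_r (1 + k * B t ^ 2)); [exact Hpos |].
      rewrite Rmult_assoc, Rinv_l by lra.
      assert (HdBt : dB t <= - (1 + k * B t ^ 2)) by (apply HdB; lra).
      nra. }
    assert (Hdrop : g (1 + PI / sqrt k) - g 1 <= - PI).
    { rewrite Heq.
      replace (- PI) with (- sqrt k * (1 + PI / sqrt k - 1)) by (field; lra).
      apply Rmult_le_compat_r; lra. }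
    pose proof (atan_bound (sqrt k * B 1)).
    pose proof (atan_bound (sqrt k * B (1 + PI / sqrt k))).
    unfold g in Hdrop; lra.
Qed.

Lemma Derive_nonneg_at_left_end (g : R -> R) (w : R) :
  0 < w -> ex_derive g 0 -> g 0 = 0 -> (forall x, 0 <= x <= w -> 0 <= g x) ->
  0 <= Derive g 0.
Proof.
  intros Hw Hex H0 Hpos.
  destruct (Rle_or_lt 0 (Derive g 0)) as [H | Hneg]; [exact H | exfalso].
  pose proof (Derive_correct g 0 Hex) as Hd.
  apply is_derive_Reals in Hd.
  destruct (Hd (- Derive g 0)) as [delta Hdelta]; [lra |].
  set (s := Rmin w (delta / 2)).
  pose proof (cond_pos delta) as Hdp.
  assert (Hs : 0 < s) by (apply Rmin_pos; lra).
  assert (Hsw : s <= w) by apply Rmin_l.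
  assert (Hsd : s <= delta / 2) by apply Rmin_r.
  assert (Hbound : Rabs ((g (0 + s) - g 0) / s - Derive g 0) < - Derive g 0).
  { apply Hdelta; [lra |]; rewrite Rabs_pos_eq; lra. }
  apply Rabs_lt_between in Hbound.
  rewrite H0, Rplus_0_l, Rminus_0_r in Hbound.
  assert (0 <= g s / s).
  { apply Rmult_le_pos; [apply Hpos; lra |].
    left; now apply Rinv_0_lt_compat. }
  lra.
Qed.

Lemma Derive_center_of_symmetry (g : R -> R) (p : R) :
  ex_derive g p -> (forall x, g (2 * p - x) = g x) -> Derive g p = 0.
Proof.
  intros Hex Hsym.
  assert (Hrefl : is_derive g p (- Derive g p)).
  { apply (is_derive_ext (fun x => g (2 * p - x))); [exact Hsym |].
    replace (- Derive g p) with (scal (-1) (Derive g p))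
      by (unfold scal; simpl; unfold mult; simpl; ring).
    apply (is_derive_comp g (fun x => 2 * p - x)).
    - replace (2 * p - p) with p by ring; now apply Derive_correct.
    - auto_derive; [trivial | ring]. }
  apply is_derive_unique in Hrefl; lra.
Qed.

Lemma RInt_even (g : R -> R) (p : R) :
  (forall x, continuous g x) -> (forall x, g (- x) = g x) ->
  RInt g (- p) p = 2 * RInt g 0 p.
Proof.
  intros Hc Hev.
  assert (Hleft : RInt g (- p) 0 = RInt g 0 p).
  { apply is_RInt_unique.
    assert (HI : is_RInt g 0 p (RInt g 0 p))
      by now apply (RInt_correct (V := R_CompleteNormedModule)),
           ex_RInt_of_continuous.
    apply is_RInt_swap, (is_RInt_opp g) in HI.
    rewrite opp_opp in HI.
    apply (is_RInt_ext (fun y => opp (opp (g (- y))))).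
    { intros x _; rewrite Hev; apply (opp_opp (g x)). }
    apply (is_RInt_comp_opp (fun y => opp (g y))).
    now rewrite Ropp_0, Ropp_involutive. }
  rewrite <- (RInt_Chasles g (- p) 0 p) by now apply ex_RInt_of_continuous.
  rewrite Hleft; unfold plus; simpl; ring.
Qed.

(** Cauchy-Schwarz against the weight [p - x], whose square is bounded by
    [p^2] on the interval.  The inequality is read off from
    [2 l (p - x) f - l^2 p^2 <= f^2] by integrating with [l = B / p^3]. *)
Lemma square_first_moment_le (f : R -> R) (p : R) :
  0 < p -> (forall x, continuous f x) ->
  (RInt (fun x => (p - x) * f x) 0 p) ^ 2 / p ^ 3
    <= RInt (fun x => f x ^ 2) 0 p.
Proof.
  intros Hp Hc.
  set (B := RInt (fun x => (p - x) * f x) 0 p).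
  set (l := B / p ^ 3).
  assert (Hm : forall x, continuous (fun x => (p - x) * f x) x).
  { intros x; apply (continuous_mult (fun x => p - x) f); [| apply Hc].
    apply (continuous_minus (fun _ : R => p) (fun x => x));
      [apply continuous_const | apply continuous_id]. }
  assert (Hq : forall x, continuous (fun x => f x ^ 2) x).
  { intros x; apply (continuous_mult f (fun x => f x * 1)); [apply Hc |].
    apply (continuous_mult f (fun _ : R => 1)); [apply Hc |].
    apply continuous_const. }
  assert (Hlin : is_RInt (fun x => 2 * l * ((p - x) * f x) - l ^ 2 * p ^ 2) 0 p
                   (2 * l * B - (p - 0) * (l ^ 2 * p ^ 2))).
  { apply (is_RInt_minus (fun x => 2 * l * ((p - x) * f x))
             (fun _ : R => l ^ 2 * p ^ 2)).
    - apply (is_RInt_scal (fun x => (p - x) * f x)).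
      now apply (RInt_correct (V := R_CompleteNormedModule)),
        ex_RInt_of_continuous.
    - apply (is_RInt_const (V := R_NormedModule)). }
  replace (B ^ 2 / p ^ 3) with (2 * l * B - (p - 0) * (l ^ 2 * p ^ 2))
    by (unfold l; field; lra).
  rewrite <- (is_RInt_unique _ _ _ _ Hlin).
  apply RInt_le; [lra | now eexists; apply Hlin
                 | now apply ex_RInt_of_continuous |].
  intros x Hx.
  assert ((p - x) ^ 2 <= p ^ 2) by nra.
  pose proof (pow2_ge_0 (f x - l * (p - x))).
  pose proof (pow2_ge_0 l).
  nra.
Qed.

(** * The first moment of the momentum flux *)

(** Integration by parts for [- P'] with [P = c g'' + g + f^2 / 2]: the
    function [- (p - x) P - c g'] is a primitive of
    [(p - x) (- P') + g + f^2 / 2]. *)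
Lemma first_moment_flux (c p : R) (g f : R -> R) :
  (forall n x, ex_derive_n g n x) ->
  (forall x, ex_derive f x) -> (forall x, continuous (Derive f) x) ->
  f 0 = 0 -> Derive g 0 = 0 -> Derive g p = 0 ->
  RInt (fun x => (p - x) *
          - (c * Derive_n g 3 x + Derive g x + f x * Derive f x)) 0 p
  = p * (c * Derive_n g 2 0 + g 0) - RInt g 0 p
    - / 2 * RInt (fun x => f x ^ 2) 0 p.
Proof.
  intros Hg Hf Hdf Hf0 Hg0 Hgp.
  assert (Cf : forall x, continuous f x)
    by (intros x; apply (ex_derive_continuous f), Hf).
  assert (Cg : forall n x, continuous (Derive_n g n) x)
    by (intros n x; apply (ex_derive_continuous (Derive_n g n)), (Hg (S n))).
  set (M := fun x => (p - x) *
          - (c * Derive_n g 3 x + Derive g x + f x * Derive f x)).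
  assert (Cq : forall x, continuous (fun x => f x ^ 2) x).
  { intros x; apply (continuous_mult f (fun x => f x * 1)); [apply Cf |].
    apply (continuous_mult f (fun _ : R => 1)); [apply Cf |].
    apply continuous_const. }
  assert (CM : forall x, continuous M x).
  { intros x; unfold M.
    apply (continuous_mult (fun x => p - x)
      (fun x => - (c * Derive_n g 3 x + Derive g x + f x * Derive f x))).
    - apply (continuous_minus (fun _ : R => p) (fun x => x));
        [apply continuous_const | apply continuous_id].
    - apply (continuous_opp
        (fun x => c * Derive_n g 3 x + Derive g x + f x * Derive f x)).
      apply (continuous_plus (fun x => c * Derive_n g 3 x + Derive g x)
               (fun x => f x * Derive f x)).
      + apply (continuous_plus (fun x => c * Derive_n g 3 x) (Derive g));
          [| apply (Cg 1%nat)].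
        apply (continuous_scal_r c (Derive_n g 3)), Cg.
      + apply (continuous_mult f (Derive f)); [apply Cf | apply Hdf]. }
  set (W := fun x =>
    - (p - x) * (c * Derive_n g 2 x + g x + / 2 * f x ^ 2) - c * Derive g x).
  set (dW := fun x => (M x + g x) + / 2 * f x ^ 2).
  assert (HW : is_RInt dW 0 p (minus (W p) (W 0))).
  { apply (is_RInt_derive (V := R_CompleteNormedModule)).
    - intros x _; unfold W, dW, M.
      assert (D1 : is_derive g x (Derive g x))
        by apply Derive_correct, (Hg 1%nat).
      assert (D2 : is_derive (Derive g) x (Derive_n g 2 x))
        by apply (Derive_correct (Derive g) x), (Hg 2%nat).
      assert (D3 : is_derive (Derive_n g 2) x (Derive_n g 3 x))
        by apply (Derive_correct (Derive_n g 2) x), (Hg 3%nat).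
      assert (Df : is_derive f x (Derive f x)) by apply Derive_correct, Hf.
      revert D2 D3 Df; generalize (Derive f x), (Derive_n g 3 x).
      generalize (Derive_n g 2); intros g2.
      revert D1; generalize (Derive g); intros g1 D1 f' g3 D2 D3 Df.
      auto_derive.
      + repeat split; eexists; eassumption.
      + rewrite (is_derive_unique (fun y : R => g y) x _ D1),
          (is_derive_unique (fun y : R => g1 y) x _ D2),
          (is_derive_unique (fun y : R => g2 y) x _ D3),
          (is_derive_unique (fun y : R => f y) x _ Df); field.
    - intros x _; unfold dW.
      apply (continuous_plus (fun x => M x + g x) (fun x => / 2 * f x ^ 2)).
      + apply (continuous_plus M g); [apply CM | apply (Cg 0%nat)].
      + apply (continuous_scal_r (/ 2) (fun x => f x ^ 2)), Cq. }
  assert (HS : is_RInt dW 0 p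
            ((RInt M 0 p + RInt g 0 p) + / 2 * RInt (fun x => f x ^ 2) 0 p)).
  { apply (is_RInt_plus (fun x => M x + g x) (fun x => / 2 * f x ^ 2)).
    - apply (is_RInt_plus M g);
        apply (RInt_correct (V := R_CompleteNormedModule)),
          ex_RInt_of_continuous; [apply CM | apply (Cg 0%nat)].
    - apply (is_RInt_scal (fun x => f x ^ 2)).
      now apply (RInt_correct (V := R_CompleteNormedModule)),
        ex_RInt_of_continuous. }
  apply (is_RInt_unique (V := R_CompleteNormedModule)) in HW, HS.
  rewrite HS in HW.
  assert (HW0 : W 0 = - p * (c * Derive_n g 2 0 + g 0))
    by (unfold W; rewrite Hf0, Hg0; ring).
  assert (HWp : W p = 0) by (unfold W; rewrite Hgp; ring).
  rewrite HW0, HWp in HW; change (minus 0 (- p * (c * Derive_n g 2 0 + g 0)))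
    with (0 - (- p * (c * Derive_n g 2 0 + g 0))) in HW.
  lra.
Qed.

(** * Smooth functions of two variables *)

Definition smooth2 (F : R -> R -> R) : Prop :=
  forall (n : nat) (x t : R), ex_diff_n F n x t.

Lemma smooth2_continuity (F : R -> R -> R) (x t : R) :
  smooth2 F -> continuity_2d_pt F x t.
Proof. intros HF; exact (proj1 (HF 0%nat x t)). Qed.

Lemma smooth2_ex_derive_1 (F : R -> R -> R) (x t : R) :
  smooth2 F -> ex_derive (fun z => F z t) x.
Proof. intros HF; exact (proj1 (proj2 (HF 1%nat x t))). Qed.

Lemma smooth2_ex_derive_2 (F : R -> R -> R) (x t : R) :
  smooth2 F -> ex_derive (fun s => F x s) t.
Proof. intros HF; exact (proj1 (proj2 (proj2 (HF 1%nat x t)))). Qed.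

Lemma smooth2_Derive_1 (F : R -> R -> R) :
  smooth2 F -> smooth2 (fun x t => Derive (fun z => F z t) x).
Proof.
  intros HF n x t; exact (proj1 (proj2 (proj2 (proj2 (HF (S n) x t))))).
Qed.

Lemma smooth2_Derive_2 (F : R -> R -> R) :
  smooth2 F -> smooth2 (fun x t => Derive (fun s => F x s) t).
Proof.
  intros HF n x t; exact (proj2 (proj2 (proj2 (proj2 (HF (S n) x t))))).
Qed.

Lemma smooth2_Derive_n_1 (F : R -> R -> R) (n : nat) :
  smooth2 F -> smooth2 (fun x t => Derive_n (fun z => F z t) n x).
Proof.
  intros HF; induction n as [| n IH]; [exact HF |].
  exact (smooth2_Derive_1 _ IH).
Qed.

Lemma smooth2_ex_derive_n_1 (F : R -> R -> R) (n : nat) (x t : R) :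
  smooth2 F -> ex_derive_n (fun z => F z t) n x.
Proof.
  intros HF; destruct n as [| n]; [exact I |].
  exact (smooth2_ex_derive_1 _ x t (smooth2_Derive_n_1 F n HF)).
Qed.

Lemma smooth2_continuous_1 (F : R -> R -> R) (x t : R) :
  smooth2 F -> continuous (fun z => F z t) x.
Proof.
  intros HF; apply (ex_derive_continuous (fun z => F z t)).
  now apply smooth2_ex_derive_1.
Qed.

Lemma is_derive_first_moment (F : R -> R -> R) (p t : R) :
  smooth2 F ->
  is_derive (fun s => RInt (fun x => (p - x) * F x s) 0 p) t
    (RInt (fun x => (p - x) * Derive (fun s => F x s) t) 0 p).
Proof.
  intros HF.
  assert (HD : forall x s, Derive (fun z => (p - x) * F x z) s
                           = (p - x) * Derive (fun z => F x z) s)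
    by (intros x s; apply Derive_scal).
  rewrite <- (RInt_ext (fun x => Derive (fun s => (p - x) * F x s) t))
    by (intros x _; apply HD).
  apply (is_derive_RInt_param (fun s x => (p - x) * F x s)).
  - apply filter_forall; intros s x _.
    now apply (ex_derive_scal (fun z => F x z)), smooth2_ex_derive_2.
  - intros x _.
    apply (continuity_2d_pt_ext
      (fun u v => (p - v) * Derive (fun z => F v z) u)).
    { intros u v; symmetry; apply HD. }
    apply continuity_2d_pt_mult.
    + apply continuity_2d_pt_minus;
        [apply continuity_2d_pt_const | apply continuity_2d_pt_id2].
    + (* [is_derive_RInt_param] takes the parameter as first variable *)
      intros eps.
      destruct (smooth2_continuity _ x t (smooth2_Derive_2 F HF) eps)
        as [delta Hd].
      exists delta; intros u v Hu Hv; now apply Hd.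
  - apply filter_forall; intros s; apply ex_RInt_of_continuous; intros x.
    apply (continuous_mult (fun x => p - x) (fun x => F x s));
      [| now apply smooth2_continuous_1].
    apply (continuous_minus (fun _ : R => p) (fun x => x));
      [apply continuous_const | apply continuous_id].
Qed.

(** * Blow-up *)

(** For [0 < t] every derivative in the momentum equation sees only times near
    [t], where [(h,u)] agrees with the smooth pair [(H,U)]; this moves the
    equation to functions that are smooth on the whole plane. *)
Lemma momentum_time_derivative (a c : R) (h u H U : R -> R -> R) (x t : R) :
  0 < t -> smooth2 H -> smooth2 U ->
  (forall y s, 0 <= s -> H y s = h y s) ->
  (forall y s, 0 <= s -> U y s = u y s) ->
  boussinesq_at a c h u x t ->
  Derive (fun s => U x s) t
  = - (c * Derive_n (fun z => H z t) 3 x + Derive (fun z => H z t) x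
       + U x t * Derive (fun z => U z t) x).
Proof.
  intros Ht SH SU EH EU [_ Heq].
  assert (Et : Derive (fun s => U x s) t = Derive (fun s => u x s) t).
  { apply Derive_ext_loc, (locally_interval _ t 0 p_infty); simpl; trivial.
    intros s Hs _; apply EU; lra. }
  assert (Ex : Derive (fun y => c * Derive_n (fun z => h z t) 2 y + h y t) x
     = c * Derive_n (fun z => H z t) 3 x + Derive (fun z => H z t) x).
  { rewrite (Derive_ext _
      (fun y => c * Derive_n (fun z => H z t) 2 y + H y t)).
    - rewrite Derive_plus.
      + now rewrite Derive_scal.
      + apply (ex_derive_scal (Derive_n (fun z => H z t) 2)).
        exact (smooth2_ex_derive_n_1 H 3 x t SH).
      + now apply smooth2_ex_derive_1.
    - intros y; rewrite EH by lra.
      rewrite (Derive_n_ext (fun z => h z t) (fun z => H z t)); [reflexivity |].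
      intros z; symmetry; apply EH; lra. }
  rewrite Ex, <- Et, <- EU in Heq by lra.
  rewrite (Derive_ext (fun y => u y t) (fun y => U y t)) in Heq
    by (intros y; symmetry; apply EU; lra).
  lra.
Qed.

Lemma smooth_upto_infty_extension (f : R -> R -> R) :
  smooth_upto p_infty f ->
  exists F, smooth2 F /\ forall x t, 0 <= t -> F x t = f x t.
Proof.
  intros [F [HF E]]; exists F; split.
  - intros n x t; now apply HF.
  - intros x t Ht; now apply E.
Qed.

Theorem theorem2p3 (a c : R) (ha : a <= 0) (hc : c <= 0)
  (h u : R -> R -> R) (Tmax : Rbar)
  (hsol : maximal_smooth_solution a c Tmax h u)
  (hmean_h : forall t : R, 0 <= t -> Rbar_lt t Tmax ->
     RInt (fun x => h x t - 1) (- PI) PI = 0)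
  (hmean_u : forall t : R, 0 <= t -> Rbar_lt t Tmax ->
     RInt (fun x => u x t) (- PI) PI = 0)
  (heven : forall x t : R, 0 <= t -> Rbar_lt t Tmax -> h (- x) t = h x t)
  (hodd : forall x t : R, 0 <= t -> Rbar_lt t Tmax -> u (- x) t = - u x t)
  (hsign : exists omega sigma : R,
     0 < omega <= PI /\ 0 < sigma /\
     forall x t : R, 0 <= x <= omega -> 0 <= t -> Rbar_lt t Tmax ->
       h x t < - sigma /\
       u x t <= 0 /\
       Derive (fun y => h y t) x >= 0 /\
       c * Derive_n (fun y => h y t) 3 x >= 0 /\
       a * Derive_n (fun y => u y t) 2 x >= 0) :
  Rbar_lt Tmax p_infty.
Proof.
  destruct hsol as [HT [[SH [SU [PH [PU Heq]]]] _]].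
  destruct Tmax as [T | |]; [exact I | exfalso | now destruct HT].
  destruct hsign as [w [sg [Hw [Hsg Hsign]]]].
  destruct (smooth_upto_infty_extension h SH) as [H [SH2 EH]].
  destruct (smooth_upto_infty_extension u SU) as [U [SU2 EU]].
  pose proof PI_RGT_0 as Hpi.
  assert (HpiGT1 : 1 < PI) by (pose proof PI2_1; lra).
  apply (no_global_riccati
    (fun t => RInt (fun x => (PI - x) * U x t) 0 PI)
    (fun t => RInt (fun x => (PI - x) * Derive (fun s => U x s) t) 0 PI)
    (/ (2 * PI ^ 3))).
  (* [2 * PI ^ 3]: the [PI ^ 3] comes from Cauchy-Schwarz, the [2] from the
     kinetic term [u^2 / 2] of the flux *)
  { apply Rinv_0_lt_compat, Rmult_lt_0_compat; [lra | now apply pow_lt]. }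
  { intros t _; now apply is_derive_first_moment. }
  intros t Ht.
  assert (Hev : forall x, H (- x) t = H x t).
  { intros x; rewrite !EH by lra; apply heven; [lra | exact I]. }
  assert (U0 : U 0 t = 0).
  { pose proof (hodd 0 t (Rlt_le _ _ Ht) I) as Ho.
    rewrite Ropp_0 in Ho; rewrite EU by lra; lra. }
  assert (dH0 : Derive (fun z => H z t) 0 = 0).
  { apply Derive_center_of_symmetry; [now apply smooth2_ex_derive_1 |].
    intros x; rewrite <- Hev; f_equal; ring. }
  (* evenness and the period [2 * PI] make [PI] a second centre of symmetry *)
  assert (dHpi : Derive (fun z => H z t) PI = 0).
  { apply Derive_center_of_symmetry; [now apply smooth2_ex_derive_1 |].
    intros x; rewrite <- (Hev x).
    replace (2 * PI - x) with (- x + 2 * PI) by ring.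
    rewrite !EH by lra; apply PH; [lra | exact I]. }
  assert (Hmean : RInt (fun x => H x t) 0 PI = PI).
  { assert (CH : forall x, continuous (fun x => H x t) x)
      by (intros x; now apply smooth2_continuous_1).
    pose proof (RInt_even (fun x => H x t) PI CH Hev) as E2.
    pose proof (hmean_h t (Rlt_le _ _ Ht) I) as Hm.
    assert (HD : is_RInt (fun x => h x t - 1) (- PI) PI
                   (RInt (fun x => H x t) (- PI) PI - (PI - - PI) * 1)).
    { apply (is_RInt_ext (fun x => H x t - 1)).
      { intros x _; now rewrite EH by lra. }
      apply (is_RInt_minus (fun x => H x t) (fun _ : R => 1)).
      - now apply (RInt_correct (V := R_CompleteNormedModule)),
          ex_RInt_of_continuous.
      - apply (is_RInt_const (V := R_NormedModule)). }
    apply (is_RInt_unique (V := R_CompleteNormedModule)) in HD.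
    lra. }
  assert (HH0 : H 0 t < 0).
  { rewrite EH by lra.
    destruct (Hsign 0 t) as [Hlt _]; [lra | lra | exact I | lra]. }
  assert (HHxx : 0 <= Derive_n (fun z => H z t) 2 0).
  { apply (Derive_nonneg_at_left_end (Derive (fun z => H z t)) w);
      [lra | exact (smooth2_ex_derive_n_1 H 2 0 t SH2) | exact dH0 |].
    intros x Hx.
    rewrite (Derive_ext _ (fun y => h y t)) by (intros y; apply EH; lra).
    destruct (Hsign x t) as [_ [_ [Hd _]]]; [lra | lra | exact I | lra]. }
  rewrite (RInt_ext _ (fun x => (PI - x) *
      - (c * Derive_n (fun z => H z t) 3 x + Derive (fun z => H z t) x
         + U x t * Derive (fun z => U z t) x))).
  2:{ intros x _; f_equal.
      apply (momentum_time_derivative a c h u); try assumption.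
      now apply Heq. }
  rewrite (first_moment_flux c PI (fun z => H z t) (fun z => U z t)).
  - pose proof (square_first_moment_le (fun z => U z t) PI Hpi
                  (fun x => smooth2_continuous_1 U x t SU2)) as HCS.
    cbv beta in HCS |- *.
    rewrite Hmean.
    set (B := RInt (fun x => (PI - x) * U x t) 0 PI) in *.
    set (Q := RInt (fun x => U x t ^ 2) 0 PI) in *.
    replace (/ (2 * PI ^ 3) * B ^ 2) with (/ 2 * (B ^ 2 / PI ^ 3))
      by (field; lra).
    assert (HP : c * Derive_n (fun z => H z t) 2 0 + H 0 t <= 0) by nra.
    apply (Rmult_le_compat_l PI) in HP; lra.
  - intros n x; now apply smooth2_ex_derive_n_1.
  - intros x; now apply smooth2_ex_derive_1.
  - intros x.
    exact (smooth2_continuous_1 _ x t (smooth2_Derive_1 U SU2)).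
  - exact U0.
  - exact dH0.
  - exact dHpi.
Qed.
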